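(* Let $n=5$, let $m^{(4)}=(m_1,m_2,m_3,m_4)$ be I-realizable on $\mathbb{N}_0$, let $\nu$ (with support $\{0,y_1,y_2\}$, $0<y_1<y_2$) and $\mu$ be the measures associated with $m^{(4)}$ as defined in the context, and suppose that $\operatorname{supp}\nu\not\subset\mathbb{N}_0$. Put $Y_j=\lfloor y_j\rfloor$ for $j=1,2$, and $$\widetilde t_1=\frac{m_4-(2Y_2+1)m_3+Y_2(Y_2+1)m_2}{m_3-(2Y_2+1)m_2+Y_2(Y_2+1)m_1},\quad \widetilde T_1=\lfloor \widetilde t_1\rfloor,$$ $$\widetilde t_2=\frac{m_4-(2Y_1+1)m_3+Y_1(Y_1+1)m_2}{m_3-(2Y_1+1)m_2+Y_1(Y_1+1)m_1},\quad \widetilde T_2=\lfloor \widetilde t_2\rfloor.$$ Then $\operatorname{supp}\mu\subset\{0,\widetilde T_1,\widetilde T_1+1,\widetilde T_2,\widetilde T_2+1\}$ with $0\in\operatorname{supp}\mu$ and $|\operatorname{supp}\mu|\ge4$; moreover $\widetilde T_2\ge\widetilde T_1+1$, so that if $\widetilde T_2>\widetilde T_1+1$ then $$x(x-\widetilde T_1)(x-\widetilde T_1-1)(x-\widetilde T_2)(x-\widetilde T_2-1)$$ is a minimizing polynomial $P_5^{(m)}$, and if $\widetilde T_2=\widetilde T_1+1$ then, for example, $$x(x-\widetilde T_1)(x-\widetilde T_2)(x-\widetilde T_2-1)(x-\widetilde T_2-2)$$ is a minimizing polynomial $P_5^{(m)}$.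
   Context: $\mathbb{N}_0=\{0,1,2,\dots\}$, $\mathbb{R}_+=[0,\infty)$. A moment vector $m=m^{(n)}=(m_1,\dots,m_n)$ is an $n$-tuple of real numbers; $m_0=1$, $m^{(j)}=(m_1,\dots,m_j)$. It is realizable on $\mathbb{X}\subset\mathbb{R}$ if there is a probability measure on $\mathbb{X}$ whose $k$-th moment is $m_k$ for $k=1,\dots,n$. For $P(x)=\sum_{k=0}^n p_kx^k$, $L_P(m)=\sum_{k=0}^n p_km_k$. For $k\ge 0$, $\mathcal{P}_k$ is the set of monic polynomials of degree $k$ with $k$ distinct roots in $\mathbb{N}_0$ which are nonnegative on $\mathbb{N}_0$ ($\mathcal{P}_0=\{1\}$). A moment vector $m^{(n)}$ realizable on $\mathbb{N}_0$ is I-realizable on $\mathbb{N}_0$ if $L_P(m)>0$ for all $P\in\mathcal{P}_n\cup\mathcal{P}_{n-1}$. A minimizing polynomial $P_n^{(m)}$ for $m^{(n)}$ is an element of $\mathcal{P}_n$ minimizing $L_P(m)$ over $P\in\mathcal{P}_n$; this property does not depend on $m_n$. Given $m^{(4)}$ I-realizable on $\mathbb{N}_0$: let $\widehat m_5$ be the smallest real value such that the Hankel matrix $(m_{i+j+1})_{i,j=0}^2$ with $m_5=\widehat m_5$ is positive semidefinite. Then $(m_1,\dots,m_4,\widehat m_5)$ is realized on $\mathbb{R}_+$ by a unique probability measure $\nu$; it has exactly three support points $0<y_1<y_2$ (one of them being $0$). Let $\widetilde m_5$ be the smallest real value for which $(m_1,\dots,m_4,\widetilde m_5)$ is realizable on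 $\mathbb{N}_0$ (equivalently $L_{P_5^{(m)}}(m_1,\dots,m_4,\widetilde m_5)=0$); it is realized on $\mathbb{N}_0$ by a unique probability measure, denoted $\mu$. *)

(* Defs.v *)
From HB Require Import structures.
From mathcomp Require Import all_boot all_order all_algebra.
From mathcomp Require Import all_classical all_reals all_analysis.

Set Implicit Arguments.
Unset Strict Implicit.
Unset Printing Implicit Defensive.

Import Order.TTheory GRing.Theory Num.Theory.
Import numFieldNormedType.Exports.

Local Open Scope classical_set_scope.
Local Open Scope ring_scope.

(* A moment vector (m_1, ..., m_n) is an [n.-tuple R], so
   its k-th moment m_k sits at position k - 1; [mom] restores m_0 = 1. *)
Definition mom (R : realType) (n : nat) (m : n.-tuple R) (k : nat) : R :=
  (1 :: m)`_k.

Definition mom_extend (R : realType) (n : nat) (m : n.-tuple R) (a : R) :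
  n.+1.-tuple R := [tuple of rcons m a].

Definition N0 (R : realType) : set R := range (fun k : nat => k%:R).
Arguments N0 R : clear implicits.

Definition Rplus (R : realType) : set R := [set x | 0 <= x].
Arguments Rplus R : clear implicits.

(* A Borel probability measure on a Borel set X is seen as a Borel probability
   measure on R giving mass 1 to X. *)
Definition realizes (R : realType) (n : nat) (X : set R) (m : n.-tuple R)
    (P : probability (measurableTypeR R) R) : Prop :=
  P X = 1%E /\
  forall k : nat, (1 <= k <= n)%N ->
    P.-integrable setT (fun x : measurableTypeR R => (x ^+ k)%:E) /\
    (\int[P]_x (x ^+ k)%:E = (mom m k)%:E)%E.

Definition realizable (R : realType) (n : nat) (X : set R) (m : n.-tuple R) :
  Prop := exists P : probability (measurableTypeR R) R, realizes X m P.

(* The closed (topological) support. *)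
Definition supp (R : realType) (P : probability (measurableTypeR R) R) :
  set R := [set x | forall U : set R, open U -> U x -> (0 < P U)%E].

(* Meaningful for polynomials of degree at most n. *)
Definition Lmom (R : realType) (n : nat) (p : {poly R}) (m : n.-tuple R) : R :=
  \sum_(k < n.+1) p`_k * mom m k.

Definition Pset (R : realType) (k : nat) : set {poly R} :=
  [set p | [/\ p \is monic, size p = k.+1,
    exists s : seq nat,
      [/\ uniq s, size s = k & forall a : nat, a \in s -> root p a%:R] &
    forall a : nat, 0 <= p.[a%:R]]].
Arguments Pset R k : clear implicits.

Definition I_realizable (R : realType) (n : nat) (m : n.-tuple R) : Prop :=
  realizable (N0 R) m /\
  forall p : {poly R}, (Pset R n `|` Pset R n.-1) p -> 0 < Lmom p m.

Definition minimizing_poly (R : realType) (n : nat) (m : n.-tuple R)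
    (p : {poly R}) : Prop :=
  Pset R n p /\ forall q : {poly R}, Pset R n q -> Lmom p m <= Lmom q m.

Definition hankel1 (R : realType) (n : nat) (m : n.-tuple R) (d : nat) :
  'M[R]_d := \matrix_(i, j) mom m (i + j + 1).

Definition psd (R : realType) (d : nat) (A : 'M[R]_d) : Prop :=
  A^T = A /\ forall v : 'cV[R]_d, 0 <= (v^T *m A *m v) 0 0.

Definition is_least (R : realType) (A : set R) (a : R) : Prop :=
  A a /\ lbound A a.

(* Main.v *)
Require Import Defs.
From HB Require Import structures.
From mathcomp Require Import all_boot all_order all_algebra.
From mathcomp Require Import all_classical all_reals all_analysis.
From mathcomp Require Import measurable_realfun ring lra zify.
Import Order.TTheory GRing.Theory Num.Theory.
Import numFieldNormedType.Exports.
Local Open Scope classical_set_scope.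
Local Open Scope ring_scope.

(** Perturbing [mu] along a divided difference at six nodes
    [0 < u < u + 1 < v < v + 1 < z] keeps [m_1, ..., m_4] and decreases [m_5], so
    minimality of [m_5] forbids positive atoms [u, v, z] of [mu] pairwise at least
    2 apart: [supp mu] lies in [{0, a, a + 1, c, c + 1}] with [c >= a + 2].
    Quartics vanishing on [supp nu] show that [mu] has atoms in each of [(0, y1)],
    [(y1, y2)] and [(y2, +oo)], while I-realizability gives the atom [0].
    The number [t1] is the zero of [t |-> L (x (x - t) (x - Y2) (x - Y2 - 1))],
    and the sign of this functional at [a] and [a + 1] can be read off [mu] or
    [nu], giving [floor t1 = a]; in the same way [floor t2 = c]. In particular
    [floor t2 >= floor t1 + 2], and the case of equality [T2 = T1 + 1] does not
    occur. *)

Set Implicit Arguments.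
Unset Strict Implicit.
Unset Printing Implicit Defensive.

(** * Topological support and moments of a probability measure *)

Section Realization.
Context {R : realType}.
Implicit Types (P : probability (measurableTypeR R) R) (p q : {poly R}).

(** Every point off the support has a null neighbourhood, which contains a null interval with
    rational endpoints around the point. There are only countably many of these; [F] enumerates
    them, with the empty set at the other indices. *)
Lemma ae_supp P : {ae P, forall x, supp P x}.
Proof.
pose F k : set R := if unpickle k is Some ab then
    if pselect (P `]ratr ab.1, ratr ab.2[%classic = 0%E) then
      `]ratr (ab.1 : rat), ratr (ab.2 : rat)[%classic else set0
  else set0.
have F0 : P.-negligible (\bigcup_k F k).
  apply: negligible_bigcup => k; rewrite /F.
  case: (unpickle k) => [[a b]|]; last exact: negligible_set0.
  case: pselect => /= [P0|_]; last exact: negligible_set0.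
  by apply/negligibleP => //; exact: measurable_itv.
apply: negligibleS F0 => x /= /existsNP[U /not_implyP[oU /not_implyP[Ux]]].
move=> /negP; rewrite -leNgt => PU0.
have /nbhs_ballP[e /= e0 xeU] : nbhs x U by exact: open_nbhs_nbhs.
have [a ax] : exists a : rat, ratr a \in `]x - e, x[.
  by apply: rat_in_itvoo; rewrite ltrBlDr ltrDl.
have [b bx] : exists b : rat, ratr b \in `]x, x + e[.
  by apply: rat_in_itvoo; rewrite ltrDl.
move: ax bx; rewrite !in_itv /= => /andP[a1 a2] /andP[b1 b2].
exists (pickle (a, b)); [exact: Logic.I | rewrite /F pickleK].
case: pselect => /= [_|[]]; first by rewrite in_itv /= a2 b1.
apply/eqP; rewrite -measure_le0; apply: le_trans PU0.
apply: le_measure; rewrite ?inE.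
- exact: measurable_itv.
- exact: open_measurable.
- move=> y /=; rewrite in_itv /= => /andP[y1 y2]; apply: xeU.
  by rewrite /ball /= ltr_norml; apply/andP; split; lra.
Qed.

Lemma realizes_poly n X (m : n.-tuple R) P p : realizes X m P ->
  (size p <= n.+1)%N ->
  P.-integrable setT (fun x : measurableTypeR R => p.[x]%:E) /\
  (\int[P]_x p.[x]%:E = (Lmom p m)%:E)%E.
Proof.
move=> [_ Pm] sp.
have mono (k : 'I_n.+1) :
    P.-integrable setT (fun x : measurableTypeR R => (x ^+ k)%:E) /\
    (\int[P]_x (x ^+ k)%:E = (mom m k)%:E)%E.
  (* [realizes] starts at order 1; order 0 is the total mass of a probability. *)
  have [->|k0] := posnP k; last by apply: Pm; rewrite k0 -ltnS /=.
  under eq_fun do rewrite expr0.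
  split; first exact: finite_measure_integrable_cst.
  by rewrite (integral_cst _ _ 1) ?mul1e; [exact: probability_setT | exact: measurableT].
have intk (k : 'I_n.+1) : P.-integrable setT
    (fun x : measurableTypeR R => (p`_k)%:E * (x ^+ k)%:E)%E.
  by apply: integrableZl => //; have [] := mono k.
have pE (x : measurableTypeR R) :
    p.[x]%:E = (\sum_(k < n.+1) (p`_k)%:E * (x ^+ k)%:E)%E.
  by rewrite (horner_coef_wide _ sp) -sumEFin.
split; first by under eq_fun do rewrite pE; exact: integrable_sum.
under eq_integral do rewrite pE.
rewrite integral_sum // /Lmom -sumEFin; apply: eq_bigr => k _.
by have [ik mk] := mono k; rewrite EFinM -mk integralZl.
Qed.

(** The support has full measure, so [p] agrees almost everywhere with its absolute value and has
    the same integral. *)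
Lemma Lmom_ge0 n X (m : n.-tuple R) P p : realizes X m P ->
  (size p <= n.+1)%N -> (forall x, supp P x -> 0 <= p.[x]) -> 0 <= Lmom p m.
Proof.
move=> Pm sp p0; have [/integrableP[mp _] E] := realizes_poly Pm sp.
have ae_abs : ae_eq P setT (fun x : measurableTypeR R => p.[x]%:E)
    (fun x => `|p.[x]%:E|%E).
  apply: negligibleS (ae_supp P) => x; apply: contra_not => /p0 ? _.
  by rewrite gee0_abs ?lee_fin.
rewrite -lee_fin -E (ae_eq_integral _ _ _ _ _ ae_abs) //.
  by apply: integral_ge0 => x _; exact: abse_ge0.
exact: measurableT_comp.
Qed.

(** A zero integral would make [p] vanish almost everywhere, while the open set where [p] is
    positive contains the support point [s] and so has positive mass. *)
Lemma Lmom_gt0 n X (m : n.-tuple R) P p (s : R) : realizes X m P ->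
  (size p <= n.+1)%N -> (forall x, supp P x -> 0 <= p.[x]) ->
  supp P s -> 0 < p.[s] -> 0 < Lmom p m.
Proof.
move=> Pm sp p0 Ps ps; rewrite lt_neqAle (Lmom_ge0 Pm) // andbT eq_sym.
apply/eqP => L0; have [/integrableP[mp _] E] := realizes_poly Pm sp.
have ae_abs : ae_eq P setT (fun x : measurableTypeR R => p.[x]%:E)
    (fun x => `|p.[x]%:E|%E).
  apply: negligibleS (ae_supp P) => x; apply: contra_not => /p0 ? _.
  by rewrite gee0_abs ?lee_fin.
have /ae_eq_integral_abs : (\int[P]_x `|p.[x]%:E| = 0)%E.
  by rewrite -(ae_eq_integral _ _ _ _ _ ae_abs) ?E ?L0 //; by exact: measurableT_comp.
move=> /(_ measurableT mp) ae0.
have oU : open [set x : R | 0 < p.[x]].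
  rewrite (_ : mkset _ = horner p @^-1` [set x | 0 < x]) //.
  by apply: open_comp; [move=> x _; exact: continuous_horner | exact: open_gt].
have := Ps _ oU ps; rewrite ltNge => /negP; apply; rewrite measure_le0; apply/eqP.
apply: measure_negligible; first exact: open_measurable.
apply: negligibleS ae0 => x /= px /(_ Logic.I) [] px0.
by rewrite px0 ltxx in px.
Qed.

End Realization.

(** * Changing the masses of finitely many atoms *)

Section Reweighting.
Context {R : realType}.
Implicit Types P : probability (measurableTypeR R) R.

Lemma measurable_N0 : measurable (N0 R : set (measurableTypeR R)).
Proof.
have -> : N0 R = \bigcup_k [set (k%:R : R)].
  by apply/seteqP; split => [x [k _ <-]|x [k _ ->]]; exists k.
by apply: bigcup_measurable => k _; exact: measurable_set1.
Qed.

Lemma N0_discrete (x : R) :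
  exists U : set R, [/\ open U, U x & U `&` N0 R `<=` [set x]].
Proof.
have /andP[] := floor_itv x; set f := Num.floor x => fx xf.
have [xE|nx] := eqVneq x f%:~R.
  exists `]x - 1, x + 1[%classic; split; first exact: itv_open.
    by rewrite /= in_itv /=; apply/andP; split; lra.
  move=> _ [/=] /[swap] -[k _ <-]; rewrite in_itv /= xE => /andP[].
  rewrite -[k%:R]/((k%:Z)%:~R) -[1]/(1%:~R) -intrB -intrD !ltr_int => ? ?.
  by congr (_%:~R); lia.
exists `]f%:~R, (f + 1)%:~R[%classic; split; first exact: itv_open.
  by rewrite /= in_itv /= xf andbT lt_neqAle eq_sym nx.
move=> _ [/=] /[swap] -[k _ <-]; rewrite in_itv /= => /andP[].
by rewrite -[k%:R]/((k%:Z)%:~R) !ltr_int => ? ?; lia.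
Qed.

(** A neighbourhood isolating [x] from the other naturals has positive mass, and all of it sits in
    [N0], hence at [x]. *)
Lemma supp_N0 P (x : R) : P (N0 R) = 1%E -> supp P x ->
  N0 R x /\ (0 < P [set x])%E.
Proof.
move=> PN sx; have [U [oU Ux UN]] := N0_discrete x.
have := sx U oU Ux.
have mU : measurable (U : set (measurableTypeR R)) by exact: open_measurable.
rewrite (measureDI P mU measurable_N0) addeC.
rewrite [X in (_ + X)%E](_ : _ = 0%E); last first.
  apply/eqP; rewrite -measure_le0.
  apply: (@le_trans _ _ (P (~` N0 R))).
    apply: le_measure; rewrite ?inE; last by move=> ? [].
      by apply: measurableD => //; exact: measurable_N0.
    by apply: measurableC; exact: measurable_N0.
  by rewrite probability_setC ?PN ?subee //; exact: measurable_N0.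
rewrite adde0 => PUN; split; last first.
  apply: lt_le_trans PUN _; apply: le_measure => //; rewrite ?inE.
    by apply: measurableI => //; exact: measurable_N0.
  exact: measurable_set1.
apply: contrapT => nx; move: PUN; suff -> : U `&` N0 R = set0.
  by rewrite measure0 ltxx.
by apply/seteqP; split => // y Uy; have := UN _ Uy => /= yx; case: Uy => _; rewrite yx.
Qed.

(* Only the mass of [c] changes, so it is enough to cut [c] out of [P] and to
   put a Dirac mass back. *)
Lemma reweight_point (P : {measure set (measurableTypeR R) -> \bar R})
    (c w : R) : P [set c] \is a fin_num -> 0 <= fine (P [set c]) + w ->
  exists Q : {measure set (measurableTypeR R) -> \bar R},
    (forall A, measurable A -> Q A = P A + (w * \1_A c)%:E)%E /\
    forall f : R -> R, P.-integrable setT (EFin \o f) ->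
      Q.-integrable setT (EFin \o f) /\
      (\int[Q]_x (f x)%:E = \int[P]_x (f x)%:E + (w * f c)%:E)%E.
Proof.
move=> Pcfin w0.
have mc : measurable (~` [set c] : set (measurableTypeR R)).
  by apply: measurableC; exact: measurable_set1.
have Pc0 : 0 <= fine (P [set c]) by exact: fine_ge0.
pose N : {measure set (measurableTypeR R) -> \bar R} := mrestr P mc.
pose D r (r0 : 0 <= r) : {measure set (measurableTypeR R) -> \bar R} :=
  mscale (NngNum r0) (dirac (c : measurableTypeR R)).
have DE r (r0 : 0 <= r) A : D r r0 A = (r * \1_A c)%:E.
  by rewrite /D /= /mscale /= diracE EFinM.
have PE A : measurable A -> P A = measure_add N (D _ Pc0) A.
  move=> mA; rewrite measure_addE DE /N /= /mrestr.
  rewrite (measureDI P mA (measurable_set1 c)) setDE indicE.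
  congr (_ + _)%E.
  have [cA|cA] := boolP (c \in A); rewrite /= ?mulr1 ?mulr0.
    by rewrite (_ : A `&` _ = [set c]) ?fineK //; apply/setIidPr => _ ->; exact: set_mem.
  rewrite (_ : A `&` _ = set0) ?measure0 //.
  apply/seteqP; split => // y [Ay yc]; rewrite yc in Ay.
  by rewrite mem_set in cA.
exists (measure_add N (D _ w0)); split=> [A mA|f fP].
  have PA : P A = (N A + (fine (P [set c]) * \1_A c)%:E)%E.
    by rewrite (PE A mA) measure_addE DE.
  by rewrite [LHS]measure_addE DE PA -addeA -EFinD -mulrDl.
have mf : measurable_fun setT (EFin \o f) by case/integrableP: fP.
have Dint r (r0 : 0 <= r) (g : R -> R) : (forall x, 0 <= g x) ->
    measurable_fun setT (EFin \o g : measurableTypeR R -> \bar R) ->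
    (\int[D r r0]_x (g x)%:E = (r * g c)%:E)%E.
  move=> g0 mg; rewrite /D ge0_integral_mscale //; last first.
    by move=> x _; rewrite lee_fin.
  by rewrite integral_dirac // diracT mul1e EFinM.
have mabs : measurable_fun setT (EFin \o (fun x => `|f x|) : measurableTypeR R -> \bar R).
  exact: (@measurableT_comp _ _ _ _ _ _ abse _ (EFin \o f)).
have Df r (r0 : 0 <= r) : (D r r0).-integrable setT (EFin \o f).
  apply/integrableP; split => //=.
  by rewrite (Dint r r0 (fun x => `|f x|)) ?ltry.
have PNf : (\int[P]_x `|(f x)%:E| = \int[N]_x `|(f x)%:E| + \int[D _ Pc0]_x `|(f x)%:E|)%E.
  rewrite -ge0_integral_measure_add //.
  by apply: eq_measure_integral => A mA _; exact: PE.
have Nf : N.-integrable setT (EFin \o f).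
  apply/integrableP; split => //; case/integrableP: fP => _; rewrite /= PNf.
  by apply: le_lt_trans; rewrite leeDl // integral_ge0.
(* The sign of [f] is not known, so [f] is replaced by the constant [f c], equal to it almost
   everywhere for a multiple of the Dirac mass at [c]. *)
have DfE r (r0 : 0 <= r) : (\int[D r r0]_x (f x)%:E = (r * f c)%:E)%E.
  rewrite (@ae_eq_integral _ _ _ _ _ (cst (f c)%:E)) //.
    by rewrite integral_cst // DE indicT mulr1 mulrC EFinM.

  have Dc0 : (D r r0).-negligible (~` [set c]).
    apply/negligibleP => //; rewrite [LHS]DE indicE memNset ?mulr0 //.
    by move=> /= /(_ erefl).
  by apply: negligibleS Dc0 => x /=; apply: contra_not => -> _.
split.
  apply/integrableP; split => //=.
  rewrite ge0_integral_measure_add // (Dint _ w0 (fun x => `|f x|)) //.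
  by apply: lte_add_pinfty; [case/integrableP: Nf | exact: ltry].
rewrite integral_measure_add // DfE.
rewrite [X in (_ = X + _)%E](_ : _ = \int[measure_add N (D _ Pc0)]_x (f x)%:E)%E.
  by rewrite integral_measure_add // DfE -addeA -EFinD -mulrDl.
by apply: eq_measure_integral => A mA _; exact: PE.
Qed.

(** Induction on the list of nodes. As the nodes are distinct, the changes already made leave the
    mass at the new node [c] as it was under [P], so the sign condition stated for [P] applies. *)
Lemma reweight (P : {measure set (measurableTypeR R) -> \bar R}) (s : seq (R * R)) :
  (P setT < +oo)%E -> uniq (map fst s) ->
  all (fun cw => 0 <= fine (P [set cw.1]) + cw.2) s ->
  exists Q : {measure set (measurableTypeR R) -> \bar R},
    (forall A, measurable A ->
      Q A = P A + (\sum_(cw <- s) cw.2 * \1_A cw.1)%:E)%E /\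
    forall f : R -> R, P.-integrable setT (EFin \o f) ->
      Q.-integrable setT (EFin \o f) /\
      (\int[Q]_x (f x)%:E =
        \int[P]_x (f x)%:E + (\sum_(cw <- s) cw.2 * f cw.1)%:E)%E.
Proof.
move=> PT; elim: s => [|[c w] s IHs] /=.
  exists P; split=> [A mA|f fP]; first by rewrite big_nil adde0.
  by rewrite big_nil adde0.
move=> /andP[cs us] /andP[w0 w0s]; have [Q [QE Qf]] := IHs us w0s.
have Qc : Q [set c] = P [set c].
  rewrite QE; last exact: measurable_set1.
  rewrite big_seq big1 ?adde0 // => -[d v] dvs /=.
  rewrite indicE memNset ?mulr0 //= => dc.
  by case/negP: cs; apply/mapP; exists (d, v).
have Pcfin : P [set c] \is a fin_num.
  rewrite ge0_fin_numE //; apply: le_lt_trans PT.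
  by apply: le_measure; rewrite ?inE //; exact: measurable_set1.
have [||Q' [Q'E Q'f]] := @reweight_point Q c w; rewrite ?Qc //.
exists Q'; split=> [A mA|f fP].
  by rewrite Q'E // QE // big_cons /= -addeA -EFinD [w * _ + _]addrC.
have [fQ E] := Qf f fP; have [fQ' E'] := Q'f f fQ.
by split=> //; rewrite E' E big_cons /= -addeA -EFinD [w * _ + _]addrC.
Qed.

Lemma reweight_realizes n (m m' : n.-tuple R) P (s : seq (nat * R)) :
  realizes (N0 R) m P -> uniq (map fst s) ->
  all (fun cw => 0 <= fine (P [set (cw.1)%:R]) + cw.2) s ->
  \sum_(cw <- s) cw.2 = 0 ->
  (forall k, (1 <= k <= n)%N ->
    mom m' k = mom m k + \sum_(cw <- s) cw.2 * (cw.1)%:R ^+ k) ->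
  realizable (N0 R) m'.
Proof.
move=> [PN Pm] us s0 sum0 m'E.
have [|||Q [QE Qf]] := @reweight P [seq (cw.1%:R, cw.2) | cw <- s].
- by apply: le_lt_trans (ltry 1); exact: probability_le1.
- rewrite -map_comp (eq_map (g := (fun n : nat => n%:R) \o fst)) //.
  by rewrite map_comp map_inj_uniq //; exact: mulrIn.
- by rewrite all_map.
have sumN0 A : (N0 R : set (measurableTypeR R)) `<=` A ->
    \sum_(cw <- [seq (cw.1%:R, cw.2) | cw <- s]) cw.2 * \1_A cw.1 = 0 :> R.
  move=> NA; rewrite big_map -[RHS]sum0; apply: eq_bigr => cw _ /=.
  by rewrite indicE mem_set ?mulr1 //; apply: NA; exists cw.1.
have QT : Q setT = 1%E by rewrite QE ?sumN0 ?adde0 //; exact: probability_setT.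
(* Normalizing gives [Q] the structure of a probability; its total mass being 1, no value changes
   and the default [P] is not taken. *)
have QE1 A : mnormalize Q P A = Q A.
  by rewrite /mnormalize QT onee_eq0 /= invr1 mule1.
have intE f : (\int[mnormalize Q P]_x f x = \int[Q]_x f x)%E.
  by apply: eq_measure_integral => A _ _; exact: QE1.
exists (mnormalize Q P); split.
  by rewrite -PN [LHS]QE1 QE ?sumN0 ?adde0 //; exact: measurable_N0.
move=> k kn; have [Pk PkE] := Pm k kn; have [/integrableP[mk Qk] QkE] := Qf _ Pk.
split; first by apply/integrableP; split; rewrite ?intE.
by rewrite intE QkE PkE m'E // big_map -EFinD.
Qed.

Lemma mom_extend_lt n (m : n.-tuple R) a k : (k <= n)%N ->
  mom (mom_extend m a) k = mom m k.
Proof. by case: k => //= k kn; rewrite /mom /= nth_rcons size_tuple kn. Qed.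

Lemma mom_extend_last n (m : n.-tuple R) a : mom (mom_extend m a) n.+1 = a.
Proof. by rewrite /mom /= nth_rcons size_tuple ltnn eqxx. Qed.

Lemma realizes_mom_extend n X (m : n.-tuple R) a P :
  realizes X (mom_extend m a) P -> realizes X m P.
Proof.
move=> [PX Pm]; split=> // k /andP[k0 kn].
by have := Pm k; rewrite k0 mom_extend_lt // leqW //; exact.
Qed.

End Reweighting.

(** * Lowering the fifth moment with a six-node divided difference *)

Section Spread.
Context {R : realType}.

(* The weights are those of the divided difference at the six nodes
   [0, u, u + 1, v, v + 1, z]: it kills polynomials of degree at most 4 and maps
   [x ^+ 5] to 1, and its coefficients alternate in sign. *)
Lemma divided_difference (u v z : R) :
  0 < u -> u + 1 < v -> v + 1 < z ->
  exists a0 a1 a2 a3 a4 a5 : R,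
    [/\ 0 < a0, 0 < a2, 0 < a4 & [/\ 0 < a1, 0 < a3 & 0 < a5]] /\
    forall k, (k <= 5)%N ->
      a0 * 0 ^+ k - a1 * u ^+ k + a2 * (u + 1) ^+ k - a3 * v ^+ k
        + a4 * (v + 1) ^+ k - a5 * z ^+ k = - (k == 5)%:R.
Proof.
move=> u0 uv vz.
exists (u * (u + 1) * v * (v + 1) * z)^-1,
  (u * (v - u) * (v + 1 - u) * (z - u))^-1,
  ((u + 1) * (v - u - 1) * (v - u) * (z - u - 1))^-1,
  (v * (v - u) * (v - u - 1) * (z - v))^-1,
  ((v + 1) * (v + 1 - u) * (v - u) * (z - v - 1))^-1,
  (z * (z - u) * (z - u - 1) * (z - v) * (z - v - 1))^-1.
split.
  by split; last split; rewrite invr_gt0; repeat apply: mulr_gt0; lra.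
have ne : [/\ u != 0, u + 1 != 0, v != 0, v + 1 != 0 & z != 0] /\
  [/\ v - u != 0, v + 1 - u != 0, z - u != 0, v - u - 1 != 0 & z - u - 1 != 0] /\
  [/\ z - v != 0 & z - v - 1 != 0].
  by do !split; lra.
case: ne => -[? ? ? ? ?] [[? ? ? ? ?] [? ?]].
do 6?[case=> [_|]]; last by [].
all: rewrite ?expr0 ?mulr1 /=; field; do ?[apply/andP; split] => //.
Qed.

Lemma minimal_not_spread (m : 4.-tuple R) (a : R)
    (mu : probability (measurableTypeR R) R) (u v z : nat) :
  is_least [set b | realizable (N0 R) (mom_extend m b)] a ->
  realizes (N0 R) (mom_extend m a) mu ->
  (0 < u)%N -> (u.+1 < v)%N -> (v.+1 < z)%N ->
  supp mu u%:R -> supp mu v%:R -> supp mu z%:R -> False.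
Proof.
move=> [_ lea] mua u0 uv vz su sv sz.
have natS (i : nat) : (i.+1)%:R = i%:R + 1 :> R by rewrite -addn1 natrD.
have [||| a0 [a1 [a2 [a3 [a4 [a5 [[p0 p2 p4 [p1 p3 p5]] dd]]]]]]] :=
  @divided_difference u%:R v%:R z%:R.
- by rewrite ltr0n.
- by rewrite -natS ltr_nat.
- by rewrite -natS ltr_nat.
have mass (x : R) : supp mu x -> 0 < fine (mu [set x]).
  move=> sx; have [_ mx] := supp_N0 mua.1 sx.
  rewrite fine_gt0 // mx /=; apply: le_lt_trans (ltry 1).
  by apply: probability_le1; exact: measurable_set1.
(* The step [e] is limited by the three nodes that lose mass: none of [u], [v], [z] may end with a
   negative mass. *)
have [e [e0 e1 e3 e5]] : exists e : R, [/\ 0 < e, e * a1 <= fine (mu [set u%:R]),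
    e * a3 <= fine (mu [set v%:R]) & e * a5 <= fine (mu [set z%:R])].
  exists (Num.min (fine (mu [set u%:R]) / a1)
    (Num.min (fine (mu [set v%:R]) / a3) (fine (mu [set z%:R]) / a5))).
  by split; rewrite -?ler_pdivlMr // ?lt_min ?ge_min ?divr_gt0 ?mass ?lexx ?orbT.
suff : realizable (N0 R) (mom_extend m (a - e)).
  by move/lea; rewrite lerBrDr gerDl leNgt e0.
pose s := [:: (0%N, e * a0); (u, - (e * a1)); (u.+1, e * a2); (v, - (e * a3));
  (v.+1, e * a4); (z, - (e * a5))].
have sumE k : (k <= 5)%N -> \sum_(cw <- s) cw.2 * (cw.1)%:R ^+ k
    = - e * (k == 5)%:R.
  move=> k5; rewrite /s !big_cons big_nil /= !natS.
  transitivity (e * - (k == 5)%:R); last by rewrite mulrN mulNr.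
  rewrite -dd //; ring.
apply: (@reweight_realizes R 5 _ _ mu s mua).
- by rewrite /= !inE; lia.
- have posw x b : 0 < b -> 0 <= fine (mu [set x]) + e * b.
    by move=> b0; rewrite addr_ge0 ?fine_ge0 // mulr_ge0 // ltW.
  by rewrite /= !posw // !subr_ge0 e1 e3 e5.
- transitivity (\sum_(cw <- s) cw.2 * (cw.1)%:R ^+ 0); last by rewrite sumE // mulr0.
  by apply: eq_bigr => cw _; rewrite expr0 mulr1.
- move=> k /andP[k0]; rewrite leq_eqVlt => /predU1P[->|k4].
    by rewrite !mom_extend_last sumE // mulr1.
  by rewrite !mom_extend_lt // sumE ?(ltnW k4) // (ltn_eqF k4) mulr0 addr0.
Qed.

End Spread.

(** * Test polynomials of degree at most four *)

Section Quartic.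
Context {R : realType}.
Implicit Types (m : 4.-tuple R) (P : probability (measurableTypeR R) R).

(** There is no constant term: all the tests below have the factor [x], so an atom at 0 contributes
    nothing. *)
Definition quartic (c1 c2 c3 c4 x : R) : R :=
  c1 * x + c2 * x ^+ 2 + c3 * x ^+ 3 + c4 * x ^+ 4.

Lemma quartic_poly m c1 c2 c3 c4 :
  let p := Poly [:: 0; c1; c2; c3; c4] in
  [/\ (size p <= 5)%N, forall x, p.[x] = quartic c1 c2 c3 c4 x &
    Lmom p m = c1 * mom m 1 + c2 * mom m 2 + c3 * mom m 3 + c4 * mom m 4].
Proof.
split; first exact: size_Poly.
  by move=> x; rewrite horner_Poly /= /quartic; ring.
by rewrite /Lmom !big_ord_recl big_ord0 !coef_Poly /=; ring.
Qed.

Lemma quartic_ge0 X m P c1 c2 c3 c4 : realizes X m P ->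
  (forall x, supp P x -> 0 <= quartic c1 c2 c3 c4 x) ->
  0 <= c1 * mom m 1 + c2 * mom m 2 + c3 * mom m 3 + c4 * mom m 4.
Proof.
move=> Pm p0; have [sp pE <-] := quartic_poly m c1 c2 c3 c4.
by apply: (Lmom_ge0 Pm sp) => x /p0; rewrite pE.
Qed.

Lemma quartic_gt0 X m P c1 c2 c3 c4 s : realizes X m P ->
  (forall x, supp P x -> 0 <= quartic c1 c2 c3 c4 x) ->
  supp P s -> 0 < quartic c1 c2 c3 c4 s ->
  0 < c1 * mom m 1 + c2 * mom m 2 + c3 * mom m 3 + c4 * mom m 4.
Proof.
move=> Pm p0 Ps ps; have [sp pE <-] := quartic_poly m c1 c2 c3 c4.
by apply: (Lmom_gt0 Pm sp _ Ps) => [x /p0|]; rewrite pE.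
Qed.

(** Both measures have the moments [m], so the polynomial has the same integral against each: at
    most 0 through [P], and positive through [P'] if it were positive at [s]. *)
Lemma quartic_separation X X' m P P' c1 c2 c3 c4 s :
  realizes X m P -> realizes X' m P' ->
  (forall x, supp P x -> quartic c1 c2 c3 c4 x <= 0) ->
  (forall x, supp P' x -> 0 <= quartic c1 c2 c3 c4 x) ->
  supp P' s -> quartic c1 c2 c3 c4 s <= 0.
Proof.
move=> Pm P'm le0 ge0 P's; rewrite leNgt; apply/negP => gt0.
have := quartic_gt0 P'm ge0 P's gt0.
have : 0 <= - c1 * mom m 1 + - c2 * mom m 2 + - c3 * mom m 3 + - c4 * mom m 4.
  apply: (quartic_ge0 Pm) => x /le0; rewrite /quartic; lra.
lra.
Qed.

(** For an integer [Y] the last factor is nonnegative on the integers, so on positive integers the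
    sign is that of [x - t] or zero. At a real point whose floor is [Y] the last factor is
    nonpositive instead. *)
Definition ratio_test (t Y x : R) : R := x * (x - t) * ((x - Y) * (x - Y - 1)).

(* [ratio_num m Y - t * ratio_den m Y] is the moment functional applied to
   [ratio_test t Y]. *)
Definition ratio_num m (Y : R) : R :=
  mom m 4 - (2 * Y + 1) * mom m 3 + Y * (Y + 1) * mom m 2.

(** The moment functional applied to [x (x - Y) (x - Y - 1)]. *)
Definition ratio_den m (Y : R) : R :=
  mom m 3 - (2 * Y + 1) * mom m 2 + Y * (Y + 1) * mom m 1.

(** Once [ratio_den m Y] is positive, this bounds the quotient defining [t1] or [t2] from below by
    [t]. Any measure with the moments [m] can supply the sign, so [nu] and [mu] both serve. *)
Lemma ratio_ge X m P t Y : realizes X m P ->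
  (forall x, supp P x -> 0 <= ratio_test t Y x) ->
  t * ratio_den m Y <= ratio_num m Y.
Proof.
move=> Pm p0.
(* These are the coefficients of [ratio_test t Y] in degrees 1 to 4. *)
have := @quartic_ge0 X m P (- t * (Y * (Y + 1))) (Y * (Y + 1) + t * (2 * Y + 1))
  (- (2 * Y + 1) - t) 1 Pm.
rewrite /ratio_num /ratio_den => L0.
suff /L0 : forall x, supp P x -> 0 <= quartic (- t * (Y * (Y + 1)))
  (Y * (Y + 1) + t * (2 * Y + 1)) (- (2 * Y + 1) - t) 1 x by lra.
by move=> x /p0; rewrite /ratio_test /quartic; lra.
Qed.

Lemma ratio_le X m P t Y : realizes X m P ->
  (forall x, supp P x -> ratio_test t Y x <= 0) ->
  ratio_num m Y <= t * ratio_den m Y.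
Proof.
move=> Pm p0.
have := @quartic_ge0 X m P (t * (Y * (Y + 1))) (- (Y * (Y + 1)) - t * (2 * Y + 1))
  (2 * Y + 1 + t) (- 1) Pm.
rewrite /ratio_num /ratio_den => L0.
suff /L0 : forall x, supp P x -> 0 <= quartic (t * (Y * (Y + 1)))
  (- (Y * (Y + 1)) - t * (2 * Y + 1)) (2 * Y + 1 + t) (- 1) x by lra.
by move=> x /p0; rewrite /ratio_test /quartic; lra.
Qed.

Lemma ratio_lt X m P t Y s : realizes X m P ->
  (forall x, supp P x -> ratio_test t Y x <= 0) ->
  supp P s -> ratio_test t Y s < 0 ->
  ratio_num m Y < t * ratio_den m Y.
Proof.
move=> Pm p0 Ps ps.
have := @quartic_gt0 X m P (t * (Y * (Y + 1))) (- (Y * (Y + 1)) - t * (2 * Y + 1))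
  (2 * Y + 1 + t) (- 1) s Pm.
rewrite /ratio_num /ratio_den => L0.
suff : 0 < quartic (t * (Y * (Y + 1)))
  (- (Y * (Y + 1)) - t * (2 * Y + 1)) (2 * Y + 1 + t) (- 1) s.
  suff /L0 /[apply] : forall x, supp P x -> 0 <= quartic (t * (Y * (Y + 1)))
    (- (Y * (Y + 1)) - t * (2 * Y + 1)) (2 * Y + 1 + t) (- 1) x.
    by move=> /(_ Ps); lra.
  by move=> x /p0; rewrite /ratio_test /quartic; lra.
by move: ps; rewrite /ratio_test /quartic; lra.
Qed.

Lemma ratio_den_gt0 X m P Y s : realizes X m P ->
  (forall x, supp P x -> 0 <= x * ((x - Y) * (x - Y - 1))) ->
  supp P s -> 0 < s * ((s - Y) * (s - Y - 1)) -> 0 < ratio_den m Y.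
Proof.
move=> Pm p0 Ps ps.
have := @quartic_gt0 X m P (Y * (Y + 1)) (- (2 * Y + 1)) 1 0 s Pm.
rewrite /ratio_den => L0.
suff : 0 < quartic (Y * (Y + 1)) (- (2 * Y + 1)) 1 0 s.
  suff /L0 /[apply] : forall x, supp P x ->
      0 <= quartic (Y * (Y + 1)) (- (2 * Y + 1)) 1 0 x.
    by move=> /(_ Ps); lra.
  by move=> x /p0; rewrite /quartic; lra.
by move: ps; rewrite /quartic; lra.
Qed.

(* The three tests are [x (x - y1) (x - y2) ^+ 2], [x (y2 - x) (x - y1) ^+ 2] and
   [x (x - y1) (x - y2)]: each vanishes on [supp nu], so none of them can be
   nonnegative on [supp mu] and positive at [s]. *)
Lemma supp_interlacing X X' m nu mu (y1 y2 s : R) :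
  realizes X m nu -> realizes X' m mu -> 0 < y1 -> y1 < y2 ->
  supp nu = [set 0; y1; y2] -> (forall x, supp mu x -> 0 <= x) ->
  supp mu s -> 0 < s -> s != y1 -> s != y2 ->
  [/\ exists2 x, supp mu x & 0 < x < y1, exists2 x, supp mu x & y1 < x < y2 &
      exists2 x, supp mu x & y2 < x].
Proof.
move=> nu_m mu_m y1_gt0 y1_lt_y2 supp_nu mu_ge0 mu_s s_gt0 s_neq1 s_neq2.
have nuP x : supp nu x -> [\/ x = 0, x = y1 | x = y2].
  by rewrite supp_nu => -[[]|] /= ->; [constructor 1|constructor 2|constructor 3].
split; apply: contrapT => no.
- have all_ge x : supp mu x -> x = 0 \/ y1 <= x.
    move=> sx; have := mu_ge0 _ sx; rewrite le_eqVlt => /predU1P[->|x0]; first by left.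
    by right; rewrite leNgt; apply/negP => xy; apply: no; exists x; rewrite ?x0.
  have := @quartic_separation X X' m nu mu (- (y1 * y2 ^+ 2))
    (2 * y1 * y2 + y2 ^+ 2) (- (y1 + 2 * y2)) 1 s nu_m mu_m.
  have qE x : quartic (- (y1 * y2 ^+ 2)) (2 * y1 * y2 + y2 ^+ 2) (- (y1 + 2 * y2)) 1 x
      = x * (x - y1) * (x - y2) ^+ 2 by rewrite /quartic; ring.
  rewrite qE => /(_ _ _ mu_s) H.
  have : s * (s - y1) * (s - y2) ^+ 2 <= 0.
    apply: H => x; rewrite qE.
      by case/nuP => ->; rewrite ?subrr ?mul0r ?mulr0 ?expr0n ?mulr0 ?mul0r.
    move=> sx; apply: mulr_ge0; last exact: sqr_ge0.
    case: (all_ge _ sx) => [->|xy]; first by rewrite mul0r.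
    by apply: mulr_ge0; lra.
  apply/negP; rewrite -ltNge; apply: mulr_gt0.
    apply: mulr_gt0 => //; rewrite subr_gt0 lt_neqAle eq_sym s_neq1.
    by case: (all_ge _ mu_s) => // s0; rewrite s0 ltxx in s_gt0.
  by rewrite exprn_even_gt0 //= subr_eq0.
(* The test [x (x - y1) (x - y2)] is negative at a positive [x] only inside the gap between [y1] and
   [y2]. *)
- have out x : supp mu x -> x <= y1 \/ y2 <= x.
    move=> sx; have [?|xy1] := leP x y1; first by left.
    by right; rewrite leNgt; apply/negP => xy; apply: no; exists x; rewrite ?xy1.
  have := @quartic_separation X X' m nu mu (y1 * y2) (- (y1 + y2)) 1 0 s nu_m mu_m.
  have qE x : quartic (y1 * y2) (- (y1 + y2)) 1 0 x = x * ((x - y1) * (x - y2)).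
    by rewrite /quartic; ring.
  rewrite qE => /(_ _ _ mu_s) H.
  have : s * ((s - y1) * (s - y2)) <= 0.
    apply: H => x; rewrite qE.
      by case/nuP => ->; rewrite ?subrr ?mul0r ?mulr0 ?mul0r.
    by move=> sx; apply: mulr_ge0; [exact: mu_ge0 | case: (out _ sx) => ?; nra].
  apply/negP; rewrite -ltNge; apply: mulr_gt0 => //.
  have [lt1|lt2] : s < y1 \/ y2 < s.
    by rewrite !lt_neqAle s_neq1 eq_sym s_neq2; exact: out.
    by rewrite nmulr_rgt0; lra.
  by rewrite mulr_gt0; lra.
- have all_le x : supp mu x -> x <= y2.
    by move=> sx; rewrite leNgt; apply/negP => xy; apply: no; exists x.
  have := @quartic_separation X X' m nu mu (y1 ^+ 2 * y2)
    (- (2 * y1 * y2 + y1 ^+ 2)) (y2 + 2 * y1) (- 1) s nu_m mu_m.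
  have qE x : quartic (y1 ^+ 2 * y2) (- (2 * y1 * y2 + y1 ^+ 2)) (y2 + 2 * y1) (- 1) x
      = x * (y2 - x) * (x - y1) ^+ 2 by rewrite /quartic; ring.
  rewrite qE => /(_ _ _ mu_s) H.
  have : s * (y2 - s) * (s - y1) ^+ 2 <= 0.
    apply: H => x; rewrite qE.
      by case/nuP => ->; rewrite ?subrr ?mul0r ?mulr0 ?expr0n ?mulr0 ?mul0r.
    move=> sx; apply: mulr_ge0; last exact: sqr_ge0.
    by apply: mulr_ge0; [exact: mu_ge0 | rewrite subr_ge0; exact: all_le].
  apply/negP; rewrite -ltNge; apply: mulr_gt0.
    by apply: mulr_gt0 => //; rewrite subr_gt0 lt_neqAle s_neq2 all_le.
  by rewrite exprn_even_gt0 //= subr_eq0.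
Qed.

End Quartic.

(** * Polynomials vanishing on the support *)

Section Minimizing.
Context {R : realType}.
Implicit Types P : probability (measurableTypeR R) R.

Lemma Pset_prod (s : seq nat) : uniq s ->
  (forall a : nat, 0 <= \prod_(i <- s) (a%:R - i%:R) :> R) ->
  Pset R (size s) (\prod_(i <- s) ('X - (i%:R)%:P)).
Proof.
move=> us s0; have sE : \prod_(i <- s) ('X - (i%:R)%:P) =
    \prod_(x <- [seq i%:R | i <- s]) ('X - x%:P) :> {poly R} by rewrite big_map.
split.
- exact: monic_prod_XsubC.
- by rewrite size_prod_XsubC.
- exists s; split=> // a als; rewrite sE root_prod_XsubC.
  by apply/mapP; exists a.
- move=> a; rewrite horner_prod; have := s0 a.
  by under eq_bigr do rewrite -(hornerXsubC _ a%:R).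
Qed.

(** If [p] vanished on the support, its functional would be 0. Hence no representing measure has its
    support inside the roots of such a [p]. *)
Lemma I_realizable_supp n (m : n.-tuple R) X P p : I_realizable m ->
  realizes X m P -> (Pset R n `|` Pset R n.-1) p ->
  ~ (forall x, supp P x -> p.[x] = 0).
Proof.
move=> [_ mI] Pm pP p0.
have : 0 <= Lmom (- p) m.
  apply: (Lmom_ge0 Pm) => [|x /p0 px]; last by rewrite hornerN px oppr0.
  by rewrite size_polyN; case: pP => -[_ -> _ _]; rewrite ?leqSpred //; case: (n).
have -> : Lmom (- p) m = - Lmom p m.
  by rewrite /Lmom -sumrN; apply: eq_bigr => k _; rewrite coefN mulNr.
by rewrite oppr_ge0 leNgt mI.
Qed.

Lemma Lmom_extend n (m : n.-tuple R) a (p : {poly R}) : (size p <= n.+1)%N ->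
  Lmom p (mom_extend m a) = Lmom p m.
Proof.
move=> sp; rewrite /Lmom big_ord_recr /= nth_default // mul0r addr0.
by apply: eq_bigr => k _; rewrite mom_extend_lt // -ltnS.
Qed.

(** Two monic polynomials of degree [n.+1] differ by one of degree at most [n], so [a] cancels in
    the comparison. On the support [q - p] equals [q], which is nonnegative at naturals. *)
Lemma minimizing_poly_supp n (m : n.-tuple R) P p a : realizes (N0 R) m P ->
  Pset R n.+1 p -> (forall x, supp P x -> p.[x] = 0) ->
  minimizing_poly (mom_extend m a) p.
Proof.
move=> Pm pP p0; split=> // q [qm sq _ q0].
have sqp : (size (q - p)%R <= n.+1)%N.
  case: pP => pm sp _ _; apply/leq_sizeP => j; rewrite leq_eqVlt => /predU1P[<-|nj].
    move/monicP: qm; move/monicP: pm.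
    by rewrite /lead_coef sp sq /= coefB => -> ->; rewrite subrr.
  by rewrite coefB !nth_default ?subrr // ?sp ?sq.
have : 0 <= Lmom (q - p) m.
  apply: (Lmom_ge0 Pm sqp) => x Px; rewrite hornerD hornerN p0 // subr0.
  by have [[k _ <-] _] := supp_N0 Pm.1 Px; exact: q0.
rewrite -(Lmom_extend m a sqp) -[Lmom p _ <= _]subr_ge0 /Lmom -sumrB.
by under eq_bigr do rewrite coefB mulrBl.
Qed.

End Minimizing.

(** * Consecutive integers and the two-block structure *)

Section Integers.
Context {R : realType}.
Implicit Types x y : R.

Lemma int_leP x y : x \is a Num.int -> y \is a Num.int -> x <= y \/ y + 1 <= x.
Proof.
move=> /intrP[a ->] /intrP[b ->]; rewrite -[1]/(1%:~R) -intrD !ler_int; lia.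
Qed.

(** No integer lies strictly between the roots [y] and [y + 1]. *)
Lemma consecutive_ge0 x y : x \is a Num.int -> y \is a Num.int ->
  0 <= (x - y) * (x - y - 1).
Proof. by move=> ix iy; case: (int_leP ix iy) => ?; nra. Qed.

Lemma consecutive_gt0 x y : x \is a Num.int -> y \is a Num.int ->
  x != y -> x != y + 1 -> 0 < (x - y) * (x - y - 1).
Proof.
move=> ix iy xy xy1; rewrite lt_neqAle consecutive_ge0 // andbT eq_sym.
by rewrite mulf_neq0 // subr_eq0 // subr_eq addrC.
Qed.

End Integers.

(** Take [a] least in [S] and [c] least in [S] beyond [a.+1]. An element beyond [c.+1] would form a
    forbidden triple with [a] and [c]. *)
Lemma two_blocks (S : nat -> Prop) (s1 s2 s3 : nat) :
  S s1 -> S s2 -> S s3 -> (s1 < s2)%N -> (s2 < s3)%N ->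
  (forall u v z, S u -> S v -> S z -> (u.+1 < v)%N -> (v.+1 < z)%N -> False) ->
  exists a c, [/\ (a.+1 < c)%N, S a, S c &
    forall k, S k -> [\/ k = a, k = a.+1, k = c | k = c.+1]].
Proof.
move=> S1 S2 S3 s12 s23 spread.
have exa : exists k, `[< S k >] by exists s1; exact/asboolP.
case: (ex_minnP exa) => a /asboolP Sa amin.
have le_a k : S k -> (a <= k)%N by move=> Sk; apply: amin; exact/asboolP.
have exc : exists k, `[< S k >] && (a.+1 < k)%N.
  (* Indeed [s3] is at least [s1 + 2], and [s1] at least [a]. *)
  exists s3; apply/andP; split; first exact/asboolP.
  by have := le_a _ S1; lia.
case: (ex_minnP exc) => c /andP[/asboolP Sc ac] cmin.
exists a, c; split=> // k Sk; have ak := le_a _ Sk.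
have [ka|ka] := leqP k a.+1.
  by have /orP[/eqP|/eqP] : (k == a) || (k == a.+1) by [lia|]; [constructor 1|constructor 2].
have ck : (c <= k)%N by apply: cmin; rewrite ka andbT; exact/asboolP.
have [kc|/(spread _ _ _ Sa Sc Sk ac)//] := leqP k c.+1.
by have /orP[/eqP|/eqP] : (k == c) || (k == c.+1) by [lia|]; [constructor 3|constructor 4].
Qed.

(** * Nonnegative polynomials whose roots are blocks of naturals *)

Section Blocks.
Context {R : realType}.

Let natS (i : nat) : (i.+1)%:R = i%:R + 1 :> R.
Proof. by rewrite -addn1 natrD. Qed.

Lemma Pset3_block (k : nat) : (0 < k)%N ->
  Pset R 3 (\prod_(i <- [:: 0; k; k.+1]%N) ('X - (i%:R)%:P)).
Proof.
move=> k0; apply: Pset_prod; first by rewrite /= !inE; lia.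
move=> x; rewrite !big_cons big_nil natS subr0 mulr1 opprD addrA.
by rewrite mulr_ge0 ?consecutive_ge0.
Qed.

Lemma Pset4_blocks (a c : nat) : (a.+1 < c)%N ->
  Pset R 4 (\prod_(i <- [:: a; a.+1; c; c.+1]%N) ('X - (i%:R)%:P)).
Proof.
move=> ac; apply: Pset_prod; first by rewrite /= !inE; lia.
move=> x; rewrite !big_cons big_nil !natS mulr1 !opprD !addrA mulrA.
by rewrite mulr_ge0 ?consecutive_ge0.
Qed.

Lemma Pset5_blocks (a c : nat) : (0 < a)%N -> (a.+1 < c)%N ->
  Pset R 5 (\prod_(i <- [:: 0; a; a.+1; c; c.+1]%N) ('X - (i%:R)%:P)).
Proof.
move=> a0 ac; apply: Pset_prod; first by rewrite /= !inE; lia.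
move=> x; rewrite !big_cons big_nil !natS subr0 mulr1 !opprD !addrA.
by rewrite mulr_ge0 // mulrA mulr_ge0 ?consecutive_ge0.
Qed.

Lemma prod_XsubC_nat_root (s : seq nat) (k : nat) : k \in s ->
  (\prod_(i <- s) ('X - (i%:R)%:P)).[k%:R] = 0 :> R.
Proof. by move=> ks; rewrite horner_prod (big_rem k) //= hornerXsubC subrr mul0r. Qed.

(** Through [Pset3_block] this excludes supports inside [{0, k, k + 1}], and through [Pset4_blocks]
    supports inside [{a, a + 1, c, c + 1}]. *)
Lemma I_realizable_not_supp (m : 4.-tuple R) X P (s : seq nat) : I_realizable m ->
  realizes X m P ->
  (Pset R 4 `|` Pset R 3) (\prod_(i <- s) ('X - (i%:R)%:P)) ->
  ~ (forall x, supp P x -> exists2 k : nat, k \in s & x = k%:R).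
Proof.
move=> mI Pm ps Ps; apply: (I_realizable_supp mI Pm ps) => x /Ps[k ks ->].
exact: prod_XsubC_nat_root.
Qed.

End Blocks.

Lemma card_set_seq (T : eqType) (s : seq T) : uniq s ->
  ([set` s] #= `I_(size s))%card.
Proof.
elim: s => [_|x s IHs /= /andP[xs us]]; first by rewrite II0 card_eq0 set_nil.
apply/eq_cardSP; exists x; first exact: mem_head.
suff -> : [set` x :: s] `\ x = [set` s] by exact: IHs.
apply/seteqP; split => y /=.
  by move=> [+ /eqP yx]; rewrite inE (negPf yx).
move=> ys; split; first by rewrite inE ys orbT.
by move=> yx; rewrite -yx ys in xs.
Qed.

(** * Locating the two quotients relative to the blocks *)

Section RatioBounds.
Context {R : realType}.

Definition in_blocks (A C x : R) : Prop :=
  [\/ x = 0, x = A | x = A + 1] \/ x = C \/ x = C + 1.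

Lemma in_blocks_left (A C x x' : R) : 1 <= A -> A + 2 <= C ->
  in_blocks A C x -> in_blocks A C x' -> 0 < x -> x < x' -> x' < C ->
  x = A /\ x' = A + 1.
Proof.
by move=> A1 AC [[]|[]] -> [[]|[]] -> x0 xx' xC; split=> //; lra.
Qed.

Lemma in_blocks_right (A C x x' : R) : 1 <= A -> A + 2 <= C ->
  in_blocks A C x -> in_blocks A C x' -> A + 1 < x -> x < x' ->
  x = C /\ x' = C + 1.
Proof.
by move=> A1 AC [[]|[]] -> [[]|[]] -> x0 xx'; split=> //; lra.
Qed.

(** Both integers are the floor of [y]. *)
Lemma int_between (x y Y : R) : x \is a Num.int -> Y \is a Num.int ->
  x <= y -> y < x + 1 -> Y <= y -> y < Y + 1 -> Y = x.
Proof.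
move=> ix iY ? ? ? ?; apply/eqP; rewrite eq_le; apply/andP; split.
  by case: (int_leP iY ix) => //; lra.
by case: (int_leP ix iY) => //; lra.
Qed.

(** [A] and [C] are too far apart to lie both in [{Y, Y + 1}]; if [A] is there, [C] exceeds
    [Y + 1]. *)
Lemma blocks_not_consecutive (A C Y : R) : A + 2 <= C ->
  A \is a Num.int -> Y \is a Num.int ->
  0 < (A - Y) * (A - Y - 1) \/ 0 < (C - Y) * (C - Y - 1).
Proof.
move=> AC iA iY; have [AY|AY] := eqVneq A Y.
  by right; rewrite mulr_gt0 //; lra.
have [AY1|AY1] := eqVneq A (Y + 1).
  by right; rewrite mulr_gt0 //; lra.
by left; apply: consecutive_gt0.
Qed.

Variables (S : R -> Prop) (N D : R -> R).

(** [S] stands for the support of [mu], [N] and [D] for [ratio_num m] and [ratio_den m]; the first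
    two premises come from [mu], the third from [nu]. The lower bound holds because no positive atom
    lies below [A]. *)
Lemma ratio_left_block (A C y1 y2 Y2 x2 x3 : R) :
  (forall t Y, (forall x, S x -> 0 <= ratio_test t Y x) -> t * D Y <= N Y) ->
  (forall t Y s, (forall x, S x -> ratio_test t Y x <= 0) -> S s -> ratio_test t Y s < 0 ->
    N Y < t * D Y) ->
  (forall t Y, ratio_test t Y y1 <= 0 -> ratio_test t Y y2 <= 0 -> N Y <= t * D Y) ->
  0 < D Y2 -> 1 <= A -> A + 2 <= C -> Y2 \is a Num.int ->
  (forall x, S x -> x \is a Num.int) -> (forall x, S x -> in_blocks A C x) ->
  S A -> S C -> S x2 -> S x3 -> y1 < x2 -> x2 < y2 -> y2 < x3 -> 0 < y1 ->
  Y2 <= y2 -> y2 < Y2 + 1 ->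
  A * D Y2 <= N Y2 /\ N Y2 < (A + 1) * D Y2.
Proof.
move=> S_ge S_lt y_le D0 A1 AC iY2 S_int S_blocks SA SC S2 S3 h1 h2 h3 y10 Yy yY.
have int_S Y x : Y \is a Num.int -> S x -> 0 <= (x - Y) * (x - Y - 1).
  by move=> iY /S_int ix; exact: consecutive_ge0.
split.
  apply: S_ge => x Sx; apply: mulr_ge0; last exact: int_S.
  by case: (S_blocks x Sx) => [[]|[]] ->; rewrite ?mul0r // mulr_ge0 //; lra.
(* If [y1 < A + 1], the measure [nu] decides with [t = y1]: the test vanishes at [y1] and is
   nonpositive at [y2], whose floor is [Y2]. *)
have [y1A|y1A] := ltP y1 (A + 1).
  apply: (@le_lt_trans _ _ (y1 * D Y2)); last by rewrite ltr_pM2r.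
  apply: y_le; first by rewrite /ratio_test subrr mulr0 mul0r.
  rewrite /ratio_test pmulr_rle0 ?mulr_gt0 ?subr_gt0 //; [nra | lra | lra].
(* Otherwise [x2] and [x3] lie beyond [A + 1], so they are [C] and [C + 1] with [y2] between them.
   With [Y2 = C] and [t = A + 1] the test vanishes at every block point except [A], where it is
   negative. *)
have [x2E x3E] : x2 = C /\ x3 = C + 1.
  by apply: (in_blocks_right A1 AC (S_blocks _ S2) (S_blocks _ S3)); lra.
have -> : Y2 = C by apply: (int_between (S_int _ SC) iY2 (y := y2)); lra.
apply: (S_lt _ _ A) => // [x Sx|]; rewrite /ratio_test.
  case: (S_blocks x Sx) => [[]|[]] ->.
  - by rewrite !mul0r.
  - apply: mulr_le0_ge0; last exact: int_S (S_int _ SC) SA.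
    by apply: mulr_ge0_le0; lra.
  - by rewrite subrr mulr0 mul0r.
  - by rewrite subrr mul0r mulr0.
  - by rewrite [C + 1 - C]addrAC subrr add0r subrr !mulr0.
rewrite pmulr_llt0; first by rewrite pmulr_rlt0; lra.
by rewrite nmulr_rgt0; lra.
Qed.

(** This mirrors [ratio_left_block]: now the upper bound is the direct one, no atom exceeding
    [C + 1], and the lower bound splits on the position of [y2]. *)
Lemma ratio_right_block (A C y1 y2 Y1 x1 x2 : R) :
  (forall t Y, (forall x, S x -> 0 <= ratio_test t Y x) -> t * D Y <= N Y) ->
  (forall t Y s, (forall x, S x -> ratio_test t Y x <= 0) -> S s -> ratio_test t Y s < 0 ->
    N Y < t * D Y) ->
  (forall t Y, 0 <= ratio_test t Y y1 -> 0 <= ratio_test t Y y2 -> t * D Y <= N Y) ->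
  0 < D Y1 -> 1 <= A -> A + 2 <= C -> Y1 \is a Num.int ->
  (forall x, S x -> x \is a Num.int) -> (forall x, S x -> in_blocks A C x) ->
  S A -> S C -> S x1 -> S x2 -> 0 < x1 -> x1 < y1 -> y1 < x2 -> x2 < y2 ->
  Y1 <= y1 -> y1 < Y1 + 1 ->
  C * D Y1 <= N Y1 /\ N Y1 < (C + 1) * D Y1.
Proof.
move=> S_ge S_lt y_ge D0 A1 AC iY1 S_int S_blocks SA SC S1 S2 h0 h1 h2 h3 Yy yY.
have int_S Y x : Y \is a Num.int -> S x -> 0 <= (x - Y) * (x - Y - 1).
  by move=> iY /S_int ix; exact: consecutive_ge0.
split.
  have [y2C|y2C] := leP C y2.
    apply: (@le_trans _ _ (y2 * D Y1)); first by rewrite ler_pM2r.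
    apply: y_ge; last by rewrite /ratio_test subrr mulr0 mul0r.
    by rewrite /ratio_test nmulr_rge0; nra.
  (* Here [y2 < C], so [x1] and [x2] fill the block [{A, A + 1}] around [y1]. With [Y1 = A] and
     [t = C] the test vanishes at every block point except [C + 1], where it is positive. *)
  have [x1E x2E] : x1 = A /\ x2 = A + 1.
    by apply: (in_blocks_left A1 AC (S_blocks _ S1) (S_blocks _ S2)); lra.
  have -> : Y1 = A by apply: (int_between (S_int _ SA) iY1 (y := y1)); lra.
  apply: S_ge => x Sx; rewrite /ratio_test.
  case: (S_blocks x Sx) => [[]|[]] ->.
  - by rewrite !mul0r.
  - by rewrite subrr mul0r mulr0.
  - by rewrite [A + 1 - A]addrAC subrr add0r subrr !mulr0.
  - by rewrite subrr mulr0 mul0r.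
  - by rewrite !mulr_ge0; lra.
have neg x : S x -> ratio_test (C + 1) Y1 x <= 0.
  move=> Sx; apply: mulr_le0_ge0; last exact: int_S.
  by apply: mulr_ge0_le0; case: (S_blocks x Sx) => [[]|[]] ->; lra.
case: (blocks_not_consecutive AC (S_int _ SA) iY1) => pos.
  by apply: (S_lt _ _ A) => //; rewrite /ratio_test pmulr_llt0 // pmulr_rlt0; lra.
by apply: (S_lt _ _ C) => //; rewrite /ratio_test pmulr_llt0 // pmulr_rlt0; lra.
Qed.

End RatioBounds.

(** * The support of the measure with least fifth moment *)

Section MinimalSupport.
Context {R : realType}.
Variables (m : 4.-tuple R) (X : set R).
Variables (nu mu : probability (measurableTypeR R) R).
Variables (y1 y2 tm5 : R).
Hypothesis hI : I_realizable m.
Hypothesis nu_m : realizes X m nu.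
Hypotheses (y1_gt0 : 0 < y1) (y1_lt_y2 : y1 < y2).
Hypothesis supp_nu : supp nu = [set 0; y1; y2].
Hypothesis nu_notN0 : ~ supp nu `<=` N0 R.
Hypothesis tm5_least : is_least [set a | realizable (N0 R) (mom_extend m a)] tm5.
Hypothesis mu_real : realizes (N0 R) (mom_extend m tm5) mu.

Let mu_m : realizes (N0 R) m mu.
Proof. exact: realizes_mom_extend mu_real. Qed.

Lemma minimal_supp_nat x : supp mu x -> exists k : nat, x = k%:R.
Proof. by move=> sx; have [[k _ <-] _] := supp_N0 mu_real.1 sx; exists k. Qed.

Lemma minimal_supp_ge0 x : supp mu x -> 0 <= x.
Proof. by case/minimal_supp_nat => k ->. Qed.

(** Otherwise the positive atoms of [mu] are among [y1] and [y2]. If both occur, [supp nu] consists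
    of naturals; if at most one occurs, [supp mu] fits in some [{0, k, k + 1}], against
    I-realizability. *)
Lemma minimal_supp_new_atom :
  exists s, [/\ supp mu s, 0 < s, s != y1 & s != y2].
Proof.
have no_block k : (0 < k)%N ->
    ~ (forall x, supp mu x -> exists2 i : nat, i \in [:: 0; k; k.+1]%N & x = i%:R).
  move=> k0; apply: (I_realizable_not_supp hI mu_m).
  by right; exact: Pset3_block.
apply: contrapT => no.
have sub x : supp mu x -> [\/ x = 0, x = y1 | x = y2].
  move=> sx; have := minimal_supp_ge0 sx; rewrite le_eqVlt => /predU1P[->|x0].
    by constructor 1.
  have [->|x1] := eqVneq x y1; first by constructor 2.
  have [->|x2] := eqVneq x y2; first by constructor 3.
  by case: no; exists x.
have [my1|my1] := pselect (supp mu y1).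
  have [k y1k] := minimal_supp_nat my1.
  have k0 : (0 < k)%N by rewrite -(ltr0n R) -y1k.
  have [my2|my2] := pselect (supp mu y2).
    have [j y2j] := minimal_supp_nat my2.
    apply: nu_notN0; rewrite supp_nu => x [[]|] ->.
    - by exists 0%N.
    - by exists k.
    - by exists j.
  apply: (no_block k k0) => x mx; case: (sub _ mx) => xE.
  - by exists 0%N; rewrite ?inE.
  - by exists k; rewrite ?inE ?eqxx ?orbT // xE.
  - by rewrite xE in mx.
have [my2|my2] := pselect (supp mu y2).
  have [k y2k] := minimal_supp_nat my2.
  have k0 : (0 < k)%N by rewrite -(ltr0n R) -y2k (lt_trans y1_gt0).
  apply: (no_block k k0) => x mx; case: (sub _ mx) => xE.
  - by exists 0%N; rewrite ?inE.
  - by rewrite xE in mx.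
  - by exists k; rewrite ?inE ?eqxx ?orbT // xE.
apply: (no_block 1%N) => // x mx; exists 0%N; rewrite ?inE //.
by case: (sub _ mx) => // xE; rewrite xE in mx.
Qed.

Lemma minimal_supp_interlacing : exists k1 k2 k3 : nat,
  [/\ supp mu k1%:R, supp mu k2%:R & supp mu k3%:R] /\
  [/\ 0 < k1%:R :> R, k1%:R < y1, y1 < k2%:R, k2%:R < y2 & y2 < k3%:R].
Proof.
have [s [mu_s s0 sy1 sy2]] := minimal_supp_new_atom.
have [[x1 mx1 /andP[x1_gt0 x1_lt]] [x2 mx2 /andP[x2_gt x2_lt]] [x3 mx3 x3_gt]] :=
  supp_interlacing nu_m mu_m y1_gt0 y1_lt_y2 supp_nu minimal_supp_ge0 mu_s s0 sy1 sy2.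
have [k1 e1] := minimal_supp_nat mx1; have [k2 e2] := minimal_supp_nat mx2.
have [k3 e3] := minimal_supp_nat mx3; subst x1 x2 x3.
by exists k1, k2, k3.
Qed.

Lemma minimal_supp_blocks : exists a c : nat,
  [/\ (0 < a)%N, (a.+1 < c)%N, supp mu a%:R & supp mu c%:R] /\
  forall k : nat, supp mu k%:R -> k \in [:: 0; a; a.+1; c; c.+1]%N.
Proof.
have [k1 [k2 [k3 [[m1 m2 m3] [k1_gt0 l1 g2 l2 g3]]]]] := minimal_supp_interlacing.
have k10 : (0 < k1)%N by rewrite -(ltr0n R).
have k12 : (k1 < k2)%N by rewrite -(ltr_nat R) (lt_trans l1).
have k23 : (k2 < k3)%N by rewrite -(ltr_nat R) (lt_trans l2).
(* Only positive atoms enter [two_blocks]: the node 0 gains mass in the perturbation, so an atom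
   there is unconstrained. *)
have [u v z [u0 mu_u] [_ mu_v] [_ mu_z] uv vz|a [c [ac [a0 ma] [_ mc] blocks]]] :=
  @two_blocks (fun k => (0 < k)%N /\ supp mu k%:R) k1 k2 k3 (conj k10 m1)
    (conj (ltn_trans k10 k12) m2) (conj (ltn_trans k10 (ltn_trans k12 k23)) m3) k12 k23.
  exact: (minimal_not_spread tm5_least mu_real u0 uv vz).
exists a, c; split=> // k mk; rewrite !inE.
have [//|k0] := posnP k.
by case: (blocks k (conj k0 mk)) => ->; rewrite eqxx ?orbT.
Qed.

Lemma minimal_supp0 : supp mu 0.
Proof.
have [a [c [[_ ac _ _] blocks]]] := minimal_supp_blocks.
apply: contrapT => n0.
apply: (I_realizable_not_supp (s := [:: a; a.+1; c; c.+1]) hI mu_m).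
  by left; exact: Pset4_blocks.
move=> x mx; have [k xk] := minimal_supp_nat mx; rewrite {}xk in mx *; exists k => //.
by have := blocks k mx; rewrite inE => /predU1P[k0|//]; rewrite k0 in mx.
Qed.

End MinimalSupport.

(** * The floors [T1] and [T2] are the left ends of the blocks *)

Theorem theorem6p10 (R : realType) (m : 4.-tuple R) (hI : I_realizable m)
  (hm5 : R)
  (hm5_least : is_least [set a | psd (hankel1 (mom_extend m a) 3)] hm5)
  (nu : probability (measurableTypeR R) R)
  (nu_real : realizes (Rplus R) (mom_extend m hm5) nu)
  (y1 y2 : R) (y1_gt0 : 0 < y1) (y1_lt_y2 : y1 < y2)
  (supp_nu : supp nu = [set 0; y1; y2])
  (tm5 : R)
  (tm5_least : is_least [set a | realizable (N0 R) (mom_extend m a)] tm5)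
  (mu : probability (measurableTypeR R) R)
  (mu_real : realizes (N0 R) (mom_extend m tm5) mu)
  (nu_notN0 : ~ supp nu `<=` N0 R) :
  let Y1 : R := (Num.floor y1)%:~R in
  let Y2 : R := (Num.floor y2)%:~R in
  let t1 : R :=
    (mom m 4 - (2 * Y2 + 1) * mom m 3 + Y2 * (Y2 + 1) * mom m 2) /
    (mom m 3 - (2 * Y2 + 1) * mom m 2 + Y2 * (Y2 + 1) * mom m 1) in
  let t2 : R :=
    (mom m 4 - (2 * Y1 + 1) * mom m 3 + Y1 * (Y1 + 1) * mom m 2) /
    (mom m 3 - (2 * Y1 + 1) * mom m 2 + Y1 * (Y1 + 1) * mom m 1) in
  let T1 : R := (Num.floor t1)%:~R in
  let T2 : R := (Num.floor t2)%:~R in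
  [/\ supp mu `<=` [set 0; T1; T1 + 1; T2; T2 + 1],
      supp mu 0,
      (`I_4 #<= supp mu)%card,
      T1 + 1 <= T2 &
      (T1 + 1 < T2 -> forall m5 : R,
         minimizing_poly (mom_extend m m5)
           ('X * ('X - T1%:P) * ('X - (T1 + 1)%:P) *
            ('X - T2%:P) * ('X - (T2 + 1)%:P))) /\
      (T2 = T1 + 1 -> forall m5 : R,
         minimizing_poly (mom_extend m m5)
           ('X * ('X - T1%:P) * ('X - T2%:P) *
            ('X - (T2 + 1)%:P) * ('X - (T2 + 2)%:P)))].
Proof.
have nu_m := realizes_mom_extend nu_real.
have mu_m := realizes_mom_extend mu_real.
have muN := minimal_supp_nat mu_real.
have [k1 [k2 [k3 [[mk1 mk2 mk3] [k1_gt0 k1_lt k2_gt k2_lt k3_gt]]]]] :=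
  minimal_supp_interlacing hI nu_m y1_gt0 y1_lt_y2 supp_nu nu_notN0 mu_real.
have [a [c [[a0 ac ma mc] blocks]]] :=
  minimal_supp_blocks hI nu_m y1_gt0 y1_lt_y2 supp_nu nu_notN0 tm5_least mu_real.
have mu0 : supp mu 0 :=
  minimal_supp0 hI nu_m y1_gt0 y1_lt_y2 supp_nu nu_notN0 tm5_least mu_real.
move=> Y1 Y2 t1 t2 T1 T2.
pose A : R := a%:R; pose C : R := c%:R.
have A1 : 1 <= A by rewrite -[1]/(1%:R) ler_nat.
have AC : A + 2 <= C by rewrite -[2]/(2%:R) -natrD ler_nat addn2.
have mu_blocks x : supp mu x -> in_blocks A C x.
  move=> mx; have [k xk] := muN x mx; rewrite {}xk in mx *.
  have := blocks k mx; rewrite !inE => /or4P[|||/orP[|]] /eqP ->; rewrite ?natr1.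
  - by left; constructor 1.
  - by left; constructor 2.
  - by left; constructor 3; rewrite natr1.
  - by right; left.
  - by right; right; rewrite natr1.
have mu_int x : supp mu x -> x \is a Num.int by case/muN => k ->.
have iY1 : Y1 \is a Num.int by exact: intr_int.
have iY2 : Y2 \is a Num.int by exact: intr_int.
have /andP[Y1le Y1gt] := floor_itv y1; rewrite intrD -/Y1 in Y1le Y1gt.
have /andP[Y2le Y2gt] := floor_itv y2; rewrite intrD -/Y2 in Y2le Y2gt.
(* The polynomial [x (x - Y) (x - Y - 1)] is nonnegative on [supp mu], and positive at one of the
   atoms [A] and [C]. *)
have den_gt0 Y : Y \is a Num.int -> 0 < ratio_den m Y.
  move=> iY; have pos x : supp mu x -> 0 <= x * ((x - Y) * (x - Y - 1)).
    move=> mx; apply: mulr_ge0; first by have [k ->] := muN x mx.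
    exact: consecutive_ge0 (mu_int x mx) iY.
  have [pos1|pos1] := blocks_not_consecutive AC (mu_int _ ma) iY.
    by apply: (ratio_den_gt0 mu_m pos ma); rewrite mulr_gt0 ?ltr0n.
  by apply: (ratio_den_gt0 mu_m pos mc); rewrite mulr_gt0 ?ltr0n // (ltn_trans _ ac).
have nu_supp (p : R -> Prop) : p 0 -> p y1 -> p y2 -> forall x, supp nu x -> p x.
  by move=> p0 p1 p2 x; rewrite supp_nu => -[[]|] ->.
have test0 t Y : ratio_test t Y 0 = 0 :> R by rewrite /ratio_test !mul0r.
have mu_ge t Y := @ratio_ge R _ m mu t Y mu_m.
have mu_lt t Y s := @ratio_lt R _ m mu t Y s mu_m.
have floor_nat (t : R) (k : nat) : k%:R <= t -> t < k%:R + 1 ->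
    (Num.floor t)%:~R = k%:R :> R.
  by move=> kt tk; rewrite (floor_def (m := k)) // intrD -pmulrn kt tk.
have T1A : T1 = A.
  have [|ge lt] := @ratio_left_block R (supp mu) (ratio_num m) (ratio_den m)
    A C y1 y2 Y2 k2%:R k3%:R mu_ge mu_lt _ (den_gt0 _ iY2) A1 AC iY2 mu_int
    mu_blocks ma mc mk2 mk3 k2_gt k2_lt k3_gt y1_gt0 Y2le Y2gt.
    move=> t Y le1 le2; apply: (ratio_le nu_m); apply: nu_supp => //.
    by rewrite test0.
  by apply: floor_nat; rewrite ?ler_pdivlMr ?ltr_pdivrMr ?den_gt0.
have T2C : T2 = C.
  have [|ge lt] := @ratio_right_block R (supp mu) (ratio_num m) (ratio_den m)
    A C y1 y2 Y1 k1%:R k2%:R mu_ge mu_lt _ (den_gt0 _ iY1) A1 AC iY1 mu_int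
    mu_blocks ma mc mk1 mk2 k1_gt0 k1_lt k2_gt k2_lt Y1le Y1gt.
    move=> t Y le1 le2; apply: (ratio_ge nu_m); apply: nu_supp => //.
    by rewrite test0.
  by apply: floor_nat; rewrite ?ler_pdivlMr ?ltr_pdivrMr ?den_gt0.
rewrite T1A T2C; split => //.
- by move=> x /mu_blocks[[]|[]] ->; rewrite /= /setU /=; tauto.
(* The atoms [k1], [k2], [k3] are separated by [y1] and [y2], hence distinct and positive; 0 is the
   fourth. *)
- have /card_set_seq/card_eqPle[_ le4] : uniq [:: 0; k1%:R; k2%:R; k3%:R : R].
    by rewrite /= !inE; lra.
  apply: card_le_trans le4 _; apply: subset_card_le => x /=.
  by rewrite !inE => /or4P[] /eqP ->.
- lra.
(* The second implication is vacuous, since [C] is at least [A + 2]. *)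
- split=> [_ m5|CA]; last by lra.
  have -> : 'X * ('X - A%:P) * ('X - (A + 1)%:P) * ('X - C%:P) * ('X - (C + 1)%:P)
      = \prod_(i <- [:: 0; a; a.+1; c; c.+1]%N) ('X - (i%:R)%:P) :> {poly R}.
    by rewrite !big_cons big_nil -!natr1 -/A -/C polyC0 subr0 mulr1 !mulrA.
  apply: (minimizing_poly_supp _ mu_m); first exact: Pset5_blocks.
  move=> x mx; have [k xk] := muN x mx; rewrite {}xk in mx *.
  exact/prod_XsubC_nat_root/blocks.
Qed.
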